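(* Assume the following hypothesis (H): for every $\theta>0$ there is $x_0(\theta)$ such that for every real $x\ge x_0(\theta)$ the interval $[x,x+x^\theta]$ contains a prime number. Then there is an absolute constant $c>0$ with the following property. For every $0<\rho_0<1$ there exist real numbers $0<\rho_1<\rho_0$ and $0<d<1$, and infinitely many primes $q$, such that: whenever $S\subseteq \mathbb{Z}/q\mathbb{Z}$ satisfies $|S|\ge \rho_1 q$ and $\mu_q(S)=r_q(\rho_1)$ (i.e. $S$ has the least number of $3$-term arithmetic progressions modulo $q$ among all subsets of $\mathbb{Z}/q\mathbb{Z}$ of density at least $\rho_1$), there exists an integer $1\le b\le q-1$ such that $$|S\cap (S+bj)|\ \ge\ |S|\left(1-\frac{c}{|\log \rho_1|}\right)\quad\text{for every integer } 0\le j\le q^d,$$ where $S+bj=\{s+bj \bmod q : s\in S\}$.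
   Context: For a positive integer $n$ and $T\subseteq \mathbb{Z}/n\mathbb{Z}$, $\mu_n(T)=\#\{(a,b,c)\in T^3 : a+b\equiv 2c \pmod n\}/n^2$ (ordered triples, trivial ones $a=b=c$ included). For $0<\rho\le 1$ and $q$ a positive integer, $r_q(\rho)=\min\{\mu_q(S): S\subseteq \mathbb{Z}/q\mathbb{Z},\ |S|\ge \rho q\}$. A subset $S$ of $\mathbb{Z}/q\mathbb{Z}$ has density at least $\rho$ if $|S|\ge\rho q$. *)

(* Defs.v *)
From HB Require Import structures.
From mathcomp Require Import all_boot all_order all_algebra.
From mathcomp Require Import reals exp.
Set Implicit Arguments. Unset Strict Implicit. Unset Printing Implicit Defensive.
Import Order.TTheory GRing.Theory Num.Theory.
Local Open Scope ring_scope.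

Definition ap3count (q : nat) (T : {set 'I_q}) : nat :=
  #|[set t : 'I_q * 'I_q * 'I_q |
      [&& t.1.1 \in T, t.1.2 \in T, t.2 \in T &
          ((t.1.1 : nat) + t.1.2 == 2 * t.2 %[mod q])%N]]|.

Definition mu (R : realType) (q : nat) (T : {set 'I_q}) : R :=
  (ap3count T)%:R / (q ^ 2)%:R.

(* r_q(rho) = min { mu_q(S) : |S| >= rho q }  (the full set always qualifies
   when rho <= 1, so the default value mu_q(setT) does not affect the min). *)
Definition rq (R : realType) (q : nat) (rho : R) : R :=
  \big[Num.min/ mu R [set: 'I_q]]_(S : {set 'I_q} | rho * q%:R <= #|S|%:R) mu R S.

Definition shift (q : nat) (S : {set 'I_q}) (k : nat) : {set 'I_q} :=
  [set x : 'I_q | [exists s in S, (x : nat) == (((s : nat) + k) %% q)%N]].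

(* Main.v *)
Require Import Defs.
From HB Require Import structures.
From mathcomp Require Import all_boot all_order all_algebra all_field.
From mathcomp Require Import zify ring lra.
From mathcomp Require Import boolp reals exp.
Set Implicit Arguments. Unset Strict Implicit. Unset Printing Implicit Defensive.
Import Order.TTheory GRing.Theory Num.Theory.
Local Open Scope ring_scope.

(** Along the densities [lam ^- m], with [lam = 1 + 1/K] and [m <= top], Behrend's
    construction makes [r_q] so small at [m = top] that the level [m] minimising
    [4096 ^ m * r_q (lam ^- m)] lies below [rho0], by Varnavides' theorem at
    density [rho0].  At this level, sets that are denser by a factor [lam ^ i]
    have at least [4096 ^ i] times as many progressions as the extremal set [S].
    Let [g] be the convolution of [S] with a progression [0, b, ..., (L-1) b]
    chosen, by pigeonhole, in a Bohr set of the large spectrum of [S]: the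
    progression count of [g / L] is at most about twice that of [S], so the level
    sets of [g] can be only slightly denser than [S].  Hence [g / L] is nearly an
    indicator function, which means that [S] is nearly invariant under
    multiples of [b]. *)

(** * Fourier analysis and weighted progression counts *)

Section Weighted.
Variable p : nat.
Notation Z := 'I_p.+2.

(** Moduli have the form [p.+2] so that ['I_p.+2] is a ring. Natural number weights cover both
    indicator functions and the convolutions [conv]. *)
Definition wcount (g : Z -> nat) : nat :=
  (\sum_x \sum_y \sum_z (x + y == z + z)%R * (g x * g y * g z))%N.

(** Convolution of the indicator of [S] with the counting measure of [tau]. Repeated values of [tau]
    count with multiplicity, so the total mass is always [#|J| * #|S|]. *)
Definition conv (J : finType) (tau : J -> Z) (S : {set Z}) (x : Z) : nat :=
  (\sum_j (x - tau j \in S)%R)%N.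

Lemma ap3countE (S : {set Z}) : ap3count S = wcount (fun x => x \in S).
Proof.
rewrite /ap3count cardsE -sum1_card big_mkcond /=.
rewrite /wcount pair_bigA pair_bigA /=; apply: eq_bigr => -[[x y] z] _ /=.
rewrite unfold_in /=.
have -> : ((x : nat) + y == 2 * z %[mod p.+2])%N = (x + y == z + z :> Z).
  by rewrite -val_eqE /= mul2n -addnn.
by case: (x \in S); case: (y \in S); case: (z \in S); case: (_ == _).
Qed.

Lemma wcount_ge (R : numDomainType) (g : Z -> nat) (W : {set Z}) (t : R) :
  0 <= t -> (forall x, x \in W -> t <= (g x)%:R) ->
  t ^+ 3 * (ap3count W)%:R <= (wcount g)%:R.
Proof.
move=> t0 tW; rewrite ap3countE /wcount.
rewrite !natr_sum mulr_sumr; apply: ler_sum => x _.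
rewrite !natr_sum mulr_sumr; apply: ler_sum => y _.
rewrite !natr_sum mulr_sumr; apply: ler_sum => z _.
rewrite !natrM mulrCA ler_wpM2l ?ler0n //.
case xW: (x \in W); last by rewrite !mul0r mulr0 !mulr_ge0 ?ler0n.
case yW: (y \in W); last by rewrite mulr0 mul0r mulr0 !mulr_ge0 ?ler0n.
case zW: (z \in W); last by rewrite !mulr0 !mulr_ge0 ?ler0n.
rewrite !mulr1 exprSr expr2.
by rewrite ler_pM ?mulr_ge0 ?tW // ler_pM ?tW.
Qed.

End Weighted.

Section Fourier.
Variables (p : nat) (z : algC).
Hypothesis z_prim : p.+2.-primitive_root z.
Notation Z := 'I_p.+2.

Definition chi (x : Z) : algC := z ^+ x.

Lemma chiD x y : chi (x + y) = chi x * chi y.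
Proof. by rewrite /chi /= (prim_expr_mod z_prim) exprD. Qed.

Lemma chi0 : chi 0 = 1. Proof. by rewrite /chi expr0. Qed.

Lemma chiM x y : chi (x * y) = chi y ^+ x.
Proof. by rewrite /chi /= (prim_expr_mod z_prim) -exprM mulnC. Qed.

Lemma chi_norm x : `|chi x| = 1.
Proof.
rewrite /chi normrX; have /eqP zq := prim_expr_order z_prim.
have: `|z| ^+ p.+2 = 1 by rewrite -normrX (eqP zq) normr1.
by move/eqP; rewrite pexpr_eq1 // => /eqP ->; rewrite expr1n.
Qed.

Lemma chiN x : chi (- x) = (chi x)^*.
Proof.
have h : chi x * chi (- x) = 1 by rewrite -chiD subrr chi0.
have h' : chi x * (chi x)^* = 1 by rewrite -normCK chi_norm expr1n.
have x0 : chi x != 0 by rewrite -normr_eq0 chi_norm oner_eq0.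
by apply: (mulfI x0); rewrite h h'.
Qed.

Lemma sum_chi x : \sum_(a : Z) chi (a * x) = (x == 0)%:R * p.+2%:R.
Proof.
have [->|x0] := eqVneq x 0.
  under eq_bigr do rewrite mulr0 chi0.
  by rewrite sumr_const card_ord mul1r.
rewrite mul0r; under eq_bigr do rewrite chiM.
have c1 : chi x - 1 != 0.
  rewrite subr_eq0 -chi0 /chi (eq_prim_root_expr z_prim) /= mod0n.
  by rewrite modn_small // -val_eqE in x0 *.
apply: (mulfI c1); rewrite mulr0 -subrX1 /chi -exprM mulnC exprM.
by rewrite (prim_expr_order z_prim) expr1n subrr.
Qed.

Definition fourier (g : Z -> nat) (a : Z) : algC :=
  \sum_x (g x)%:R * chi (a * x).

(** By [sum_chi], summing [chi (a * (x + y - (t + t)))] over [a] detects progressions, and the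
    summand splits into the frequencies [a], [a] and [- (a + a)]. *)
Lemma fourier_wcount g :
  p.+2%:R * (wcount g)%:R
  = \sum_a fourier g a ^+ 2 * fourier g (- (a + a)) :> algC.
Proof.
have E a : fourier g a ^+ 2 * fourier g (- (a + a)) =
  \sum_x \sum_y \sum_t ((g x * g y * g t)%N)%:R * chi (a * (x + y - (t + t))).
  rewrite expr2 /fourier !mulr_suml; apply: eq_bigr => x _.
  rewrite -mulrA mulr_suml mulr_sumr; apply: eq_bigr => y _.
  rewrite mulrA mulr_sumr; apply: eq_bigr => t _.
  rewrite !natrM.
  have -> : a * (x + y - (t + t)) = a * x + a * y + (- (a + a) * t) by ring.
  by rewrite !chiD; ring.
under eq_bigr do rewrite E.
rewrite [RHS]exchange_big /= /wcount natr_sum mulr_sumr; apply: eq_bigr => x _.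
rewrite [RHS]exchange_big /= natr_sum mulr_sumr; apply: eq_bigr => y _.
rewrite [RHS]exchange_big /= natr_sum mulr_sumr; apply: eq_bigr => t _.
by rewrite -mulr_sumr sum_chi subr_eq0 natrM; ring.
Qed.

Lemma parseval g :
  \sum_a `|fourier g a| ^+ 2 = p.+2%:R * (\sum_x g x ^ 2)%N%:R.
Proof.
have E a : `|fourier g a| ^+ 2 =
  \sum_x \sum_y ((g x * g y)%N)%:R * chi (a * (x - y)).
  rewrite normCK /fourier rmorph_sum /= mulr_suml; apply: eq_bigr => x _.
  rewrite mulr_sumr; apply: eq_bigr => y _.
  by rewrite mulrBr chiD -mulrN mulrN chiN rmorphM /= conjC_nat natrM; ring.
rewrite (eq_bigr _ (fun a _ => E a)).
rewrite exchange_big /= natr_sum mulr_sumr; apply: eq_bigr => x _.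
rewrite exchange_big /=.
rewrite (bigD1 x) //= [X in _ + X]big1 ?addr0; last first.
  by move=> y yx; rewrite -mulr_sumr sum_chi subr_eq0 eq_sym (negPf yx) mul0r mulr0.
by rewrite -mulr_sumr sum_chi subrr eqxx mul1r mulrC expnS expn1.
Qed.

Lemma parseval_set (S : {set Z}) :
  \sum_a `|fourier (fun x => x \in S) a| ^+ 2 <= p.+2%:R ^+ 2.
Proof.
rewrite parseval expr2 ler_wpM2l ?ler0n // ler_nat.
rewrite -[leqRHS](card_ord p.+2) -sum1_card leq_sum // => x _.
by case: (x \in S).
Qed.

Lemma fourier_conv (J : finType) (tau : J -> Z) S a :
  fourier (conv tau S) a
  = fourier (fun x => x \in S) a * \sum_j chi (a * tau j).
Proof.
rewrite /fourier /conv mulr_sumr.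
under eq_bigr do rewrite natr_sum mulr_suml.
rewrite exchange_big /=; apply: eq_bigr => j _.
rewrite (reindex_inj (addrI (tau j))) /= mulr_suml; apply: eq_bigr => x _.
by rewrite (addrC (tau j)) addrK mulrDr chiD mulrA.
Qed.

Hypothesis p_odd : odd p.

Lemma double_inj : injective (fun a : Z => - (a + a)).
Proof.
(* The modulus is odd, so [h] is an inverse of 2. *)
pose h : Z := (uphalf p.+2)%:R.
have hh : h + h = 1.
  rewrite -natrD; have -> : (uphalf p.+2 + uphalf p.+2 = p.+3)%N by lia.
  have q0 : p.+2%:R = 0 :> Z by apply: val_inj; rewrite Zp_nat /= modnn.
  by rewrite -natr1 q0 add0r.
move=> a b /oppr_inj ab.
by rewrite -[a]mulr1 -[b]mulr1 -hh !mulrDr -!mulrDl ab.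
Qed.

(** The large spectrum is read at [- (a + a)] because this factor of [fourier_wcount] will be
    bounded pointwise, while Parseval handles the two factors at [a]. *)
Definition spectrum (S : {set Z}) (n : nat) : {set Z} :=
  [set a | p.+2%:R <= n%:R * `|fourier (fun x => x \in S) (- (a + a))|].

(** Parseval limits the number of large coefficients, and doubling permutes the frequencies. *)
Lemma card_spectrum S n : (#|spectrum S n| <= n ^ 2)%N.
Proof.
have := parseval_set S; rewrite (reindex_inj double_inj) /=.
set G := fun a => `|fourier (fun x => x \in S) (- (a + a))|.
move=> le1; have q0 : 0 < p.+2%:R ^+ 2 :> algC by rewrite exprn_gt0 ?ltr0n.
rewrite -(ler_nat algC) -(ler_pM2r q0) natrX -exprMn.
apply: le_trans (_ : \sum_(a in spectrum S n) (n%:R * G a) ^+ 2 <= _).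
  rewrite -sum1_card natr_sum mulr_suml ler_sum // => a.
  by rewrite inE mul1r => ha; rewrite lerXn2r // nnegrE ?mulr_ge0 ?ler0n // /G.
apply: le_trans (_ : \sum_a (n%:R * G a) ^+ 2 <= _).
  rewrite [leRHS](bigID [pred a | a \in spectrum S n]) /= lerDl sumr_ge0 // => a _.
  by rewrite exprn_ge0 // mulr_ge0 ?ler0n // /G.
under eq_bigr do rewrite exprMn.
by rewrite -mulr_sumr exprMn ler_wpM2l ?exprn_ge0 ?ler0n.
Qed.

Lemma chi_double x : `|chi (- (x + x)) - 1| <= 2%:R * `|chi x - 1|.
Proof.
have -> : chi (- (x + x)) - 1 = (chi (x + x) - 1)^* by rewrite rmorphB rmorph1 chiN.
rewrite norm_conjC chiD.
have -> : chi x * chi x - 1 = chi x * (chi x - 1) + (chi x - 1) by ring.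
by rewrite (le_trans (ler_normD _ _)) // normrM chi_norm mul1r mulr_natl mulr2n.
Qed.

(** Convolving multiplies the term at [a] in [fourier_wcount] by [P a ^+ 2 * P (- (a + a))]. On the
    spectrum this factor is close to [#|J| ^ 3]; off it, the coefficient at [- (a + a)] is small.
    Parseval sums both errors. *)
Lemma conv_approx (n : nat) (S : {set Z}) (J : finType) (tau : J -> Z) :
  (0 < n)%N ->
  (forall a j, a \in spectrum S n -> n%:R * `|chi (a * tau j) - 1| <= 1) ->
  (n * wcount (conv tau S) <= #|J| ^ 3 * (n * ap3count S + 4 * p.+2 ^ 2))%N.
Proof.
move=> n0 small; set m := #|J|.
pose F := fourier (fun x => x \in S).
pose P a := \sum_j chi (a * tau j).
have sumB (f : J -> algC) b : (forall j, `|f j| <= b) -> `|\sum_j f j| <= m%:R * b.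
  move=> fb; apply: le_trans (ler_norm_sum _ _ _) _.
  apply: le_trans (ler_sum _ (fun j _ => fb j)) _.
  by rewrite sumr_const mulr_natl.
have P1 a : `|P a| <= m%:R.
  by rewrite -[m%:R]mulr1; apply: sumB => j; rewrite chi_norm.
have PB a : P a - m%:R = \sum_j (chi (a * tau j) - 1).
  by rewrite sumrB sumr_const.
have nV : 0 < n%:R^-1 :> algC by rewrite invr_gt0 ltr0n.
have n0' : n%:R != 0 :> algC by rewrite pnatr_eq0 -lt0n.
have m0 : 0 <= m%:R :> algC by rewrite ler0n.
have Pn a : a \in spectrum S n -> `|P a - m%:R| <= m%:R * n%:R^-1.
  move=> aS; rewrite PB; apply: sumB => j.
  by rewrite -[n%:R^-1]mulr1 ler_pdivlMl ?ltr0n // small.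
have Pn2 a : a \in spectrum S n -> `|P (- (a + a)) - m%:R| <= m%:R * (2%:R * n%:R^-1).
  move=> aS; rewrite PB; apply: sumB => j.
  rewrite mulNr mulrDl; apply: le_trans (chi_double _) _.
  by rewrite ler_pM2l ?ltr0n // -[n%:R^-1]mulr1 ler_pdivlMl ?ltr0n // small.
have F1 a : `|F a| <= p.+2%:R.
  apply: le_trans (ler_norm_sum _ _ _) _.
  apply: le_trans (_ : \sum_(x : Z) 1 <= _); last by rewrite sumr_const card_ord.
  apply: ler_sum => x _; rewrite normrM chi_norm mulr1.
  by case: (x \in S); rewrite ?normr1 // normr0 ler01.
have main a : `|F (- (a + a))| * `|P a ^+ 2 * P (- (a + a)) - m%:R ^+ 3|
    <= p.+2%:R * (m%:R ^+ 3 * (4%:R * n%:R^-1)).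
  case aS: (a \in spectrum S n).
    apply: ler_pM => //.
    (* Replacing the three factors by [m] one at a time costs relative errors [2 / n], [1 / n] and
       [1 / n], whence the constant 4. *)
    have -> : P a ^+ 2 * P (- (a + a)) - m%:R ^+ 3 =
      P a ^+ 2 * (P (- (a + a)) - m%:R) + m%:R * (P a * (P a - m%:R))
      + m%:R ^+ 2 * (P a - m%:R) by ring.
    have -> : m%:R ^+ 3 * (4%:R * n%:R^-1) =
       m%:R ^+ 2 * (m%:R * (2%:R * n%:R^-1)) + m%:R * (m%:R * (m%:R * n%:R^-1))
       + m%:R ^+ 2 * (m%:R * n%:R^-1) :> algC by ring.
    apply: le_trans (ler_normD _ _) _; apply: lerD; last first.
      by rewrite normrM normrX normr_nat ler_wpM2l ?exprn_ge0 ?Pn.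
    apply: le_trans (ler_normD _ _) _; apply: lerD.
      by rewrite normrM normrX ler_pM ?exprn_ge0 ?Pn2 // lerXn2r ?nnegrE ?P1.
    by rewrite !normrM normr_nat ler_wpM2l // ler_pM ?Pn ?P1.
  have Fs : `|F (- (a + a))| <= p.+2%:R * n%:R^-1.
    move: aS; rewrite inE => /negbT; rewrite -real_ltNge ?rpredM ?realn ?normr_real //.
    by move/ltW; rewrite mulrC -ler_pdivlMr ?ltr0n.
  have -> : p.+2%:R * (m%:R ^+ 3 * (4%:R * n%:R^-1)) =
    (p.+2%:R * n%:R^-1) * (m%:R ^+ 3 * 4%:R) :> algC by ring.
  apply: ler_pM => //; apply: le_trans (ler_normB _ _) _.
  have -> : m%:R ^+ 3 * 4%:R =
    m%:R ^+ 2 * m%:R + m%:R ^+ 3 + m%:R ^+ 3 *+ 2 :> algC by ring.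
  rewrite -[leLHS]addr0; apply: lerD; last by rewrite mulrn_wge0 ?exprn_ge0.
  apply: lerD; last by rewrite normrX normr_nat.
  by rewrite normrM normrX ler_pM ?exprn_ge0 ?P1 // lerXn2r ?nnegrE ?P1.
have diff : `|p.+2%:R * ((wcount (conv tau S))%:R - m%:R ^+ 3 * (ap3count S)%:R) : algC|
   <= p.+2%:R * (m%:R ^+ 3 * (4%:R * n%:R^-1)) * p.+2%:R ^+ 2.
  have -> : p.+2%:R * ((wcount (conv tau S))%:R - m%:R ^+ 3 * (ap3count S)%:R) =
    \sum_a F a ^+ 2 * (F (- (a + a)) * (P a ^+ 2 * P (- (a + a)) - m%:R ^+ 3)).
    rewrite ap3countE mulrBr mulrCA !fourier_wcount mulr_sumr -sumrB.
    apply: eq_bigr => a _; rewrite !fourier_conv -/F -/(P a) -/(P (- (a + a))); ring.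
  apply: le_trans (ler_norm_sum _ _ _) _.
  apply: le_trans (_ : \sum_a `|F a| ^+ 2 * (p.+2%:R * (m%:R ^+ 3 * (4%:R * n%:R^-1))) <= _).
    by apply: ler_sum => a _; rewrite normrM normrX normrM ler_wpM2l ?exprn_ge0 ?main.
  rewrite -mulr_suml mulrC ler_wpM2l ?parseval_set //.
  by rewrite !mulr_ge0 ?ler0n ?exprn_ge0 // ltW.
have q0 : 0 < p.+2%:R :> algC by rewrite ltr0n.
move: diff; rewrite normrM normr_nat -mulrA ler_pM2l // => diff.
have dr : (wcount (conv tau S))%:R - m%:R ^+ 3 * (ap3count S)%:R \is @Num.real algC.
  by rewrite rpredB ?rpredM ?rpredX ?realn.
move: (le_trans (real_ler_norm dr) diff); rewrite lerBlDl => diff'.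
rewrite -(ler_nat algC) !(natrM, natrD, natrX).
apply: le_trans (ler_wpM2l (ler0n _ _) diff') _.
rewrite le_eqVlt; apply/orP; left; apply/eqP; field.
exact: n0'.
Qed.

End Fourier.

(** * Bohr sets *)

Section Pigeonhole.
Variables (p : nat) (z : algC).
Hypothesis z_prim : p.+2.-primitive_root z.
Notation Z := 'I_p.+2.

Lemma pigeonhole (T Y : finType) (c : T -> Y) : (0 < #|T|)%N ->
  exists y, (#|T| <= #|Y| * #|[set t | c t == y]|)%N.
Proof.
move=> T0; apply/existsP; apply: contraLR T0 => /existsPn h; rewrite -leqNgt.
have sumT : #|T| = (\sum_y #|[set t | c t == y]|)%N.
  rewrite -sum1_card (partition_big c predT) //=; apply: eq_bigr => y _.
  by rewrite -sum1_card; apply: eq_bigl => t; rewrite inE.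
have le : (#|Y| * #|T| <= #|Y| * #|T|.-1)%N.
  rewrite {1}sumT big_distrr /= -sum_nat_const leq_sum // => y _.
  by have := h y; rewrite -ltnNge; case: #|T|.
have [->//|T0] := posnP #|T|; have [t _] := card_gt0P T0.
have Y0 : (0 < #|Y|)%N by apply/card_gt0P; exists (c t).
by move: le; rewrite leq_pmul2l //; case: #|T| T0 => // m _; rewrite ltnn.
Qed.

(** Cells of width [1 / M] on [[-1, 1]]; the additional cell receives the right end [w = 1]. *)
Definition bin (M : nat) (w : algC) : 'I_(2 * M).+1 := inord (Num.truncn (M%:R * (w + 1))).

Lemma bin_close M (w w' : algC) : w \is Num.real -> w' \is Num.real ->
  `|w| <= 1 -> `|w'| <= 1 -> bin M w = bin M w' -> M%:R * `|w - w'| <= 1.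
Proof.
move=> wr w'r w1 w'1 /(congr1 val).
have pos (v : algC) : v \is Num.real -> `|v| <= 1 -> 0 <= M%:R * (v + 1).
  by move=> vr; rewrite real_ler_norml // => /andP[v1 _]; rewrite mulr_ge0 ?ler0n // -lerBlDr sub0r.
have lt (v : algC) : v \is Num.real -> `|v| <= 1 -> (Num.truncn (M%:R * (v + 1)) < (2 * M).+1)%N.
  move=> vr v1; rewrite ltnS -(ler_nat algC).
  apply: le_trans (_ : M%:R * (v + 1) <= _).
    by have /andP[] := truncn_itv (pos v vr v1).
  rewrite natrM mulrC ler_wpM2r ?ler0n //.
  by move: v1; rewrite real_ler_norml // => /andP[_ v1]; rewrite -[2%:R]/(1 + 1) lerD2r.
rewrite /bin /= !inordK ?lt // => e.
have /andP[a1 a2] := truncn_itv (pos _ wr w1).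
have /andP[b1 b2] := truncn_itv (pos _ w'r w'1).
rewrite -[M%:R]ger0_norm ?ler0n // -normrM.
have -> : M%:R * (w - w') = M%:R * (w + 1) - M%:R * (w' + 1) by ring.
move: a1 a2 b1 b2; rewrite e -!natr1 => a1 a2 b1 b2.
rewrite real_ler_norml ?rpredB ?rpredM ?rpredD ?realn ?real1 //.
rewrite lerBrDr lerBlDr; apply/andP; split.
  apply: le_trans a1; rewrite addrC lerBlDr; exact: ltW.
by apply: le_trans (ltW a2) _; rewrite addrC lerD2l.
Qed.

(** Colour [t] by the cells of the real and imaginary parts of all [chi z (a * t)] and take a
    popular colour class. The bound 2 adds the errors of the two parts. *)
Lemma simultaneous_bin (A : {set Z}) (M : nat) :
  exists T : {set Z}, (p.+2 <= ((2 * M).+1 ^ 2) ^ #|A| * #|T|)%N /\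
    {in T &, forall t t', {in A, forall a,
       M%:R * `|chi z (a * (t - t')) - 1| <= 2%:R}}.
Proof.
pose c (t : Z) : {ffun 'I_#|A| -> 'I_(2 * M).+1 * 'I_(2 * M).+1} :=
  [ffun i => (bin M ('Re (chi z (enum_val i * t))), bin M ('Im (chi z (enum_val i * t))))].
have [|y hy] := pigeonhole c; first by rewrite card_ord.
exists [set t | c t == y]; split.
  by move: hy; rewrite card_ffun card_prod !card_ord expnS expn1.
move=> t t'; rewrite !inE => /eqP <- /eqP ct a aA.
have := congr1 (fun f : {ffun _} => f (enum_rank_in aA a)) ct.
rewrite !ffunE enum_rankK_in // => -[e1 e2].
have nR (u : Z) : `|'Re (chi z u)| <= 1.
  by rewrite -(chi_norm z_prim u) leif_normC_Re_Creal.
have nI (u : Z) : `|'Im (chi z u)| <= 1.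
  rewrite -(@expr_le1 _ 2) // real_normK ?Creal_Im //.
  have := normC2_Re_Im (chi z u); rewrite (chi_norm z_prim) expr1n => ->.
  by rewrite lerDr -real_normK ?Creal_Re // exprn_ge0.
have c1 := bin_close (Creal_Re _) (Creal_Re _) (nR _) (nR _) e1.
have c2 := bin_close (Creal_Im _) (Creal_Im _) (nI _) (nI _) e2.
have -> : `|chi z (a * (t - t')) - 1| = `|chi z (a * t') - chi z (a * t)|.
  rewrite mulrBr (chiD z_prim) -[RHS]normrN opprB.
  have -> : chi z (a * t) - chi z (a * t') = chi z (a * t') * (chi z (a * t) * chi z (- (a * t')) - 1).
    have e : chi z (a * t') * chi z (- (a * t')) = 1 by rewrite -(chiD z_prim) subrr chi0.
    by rewrite mulrBr mulr1 mulrCA e mulr1.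
  by rewrite normrM (chi_norm z_prim) mul1r.
set u := chi z (a * t') in c1 c2 *; set v := chi z (a * t) in c1 c2 *.
have -> : u - v = ('Re u - 'Re v) + 'i * ('Im u - 'Im v).
  by rewrite {1}[u]Crect {1}[v]Crect; ring.
apply: le_trans (ler_wpM2l (ler0n _ _) (ler_normD _ _)) _.
by rewrite normrM normCi mul1r mulrDr -[2%:R]/(1 + 1) lerD.
Qed.

End Pigeonhole.

(** A popular colour class, translated to contain 0, lies in the Bohr set of the spectrum. It fills
    a proportion of the group that depends on [n] only. *)
Lemma dense_conv (p n : nat) (S : {set 'I_p.+2}) : odd p -> (0 < n)%N ->
  exists L (tau : 'I_L -> 'I_p.+2), [/\ injective tau,
    (p.+2 <= ((4 * n).+1 ^ 2) ^ (n ^ 2) * L)%N &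
    (n * wcount (conv tau S) <= L ^ 3 * (n * ap3count S + 4 * p.+2 ^ 2))%N].
Proof.
move=> podd n0; have [z zp] := C_prim_root_exists (ltn0Sn p.+1).
have [T [cT hT]] := simultaneous_bin zp (spectrum z S n) (2 * n).
have T0 : (0 < #|T|)%N by rewrite lt0n; apply: contraL cT => /eqP ->; rewrite muln0.
have [t0 t0T] := card_gt0P T0.
exists #|T|, (fun i => enum_val i - t0); split.
- by move=> i j /addIr /enum_val_inj.
- apply: leq_trans cT _; rewrite leq_mul2r mulnA leq_exp2l ?(card_spectrum zp podd) ?orbT //.
  by rewrite -[1%N](exp1n 2) ltn_exp2r // ltnS; lia.
- have := conv_approx zp n0 (S := S) (tau := fun i : 'I_#|T| => enum_val i - t0).
  rewrite card_ord; apply=> a i aS.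
  have := hT _ _ (enum_valP i) t0T a aS.
  by rewrite natrM -mulrA ger_pMr ?ltr0n.
Qed.

(** Two elements of one colour class are enough, and the lower bound on the modulus provides them. A
    precision finer by the factor [L] keeps every [b *+ j] with [j < L] in the Bohr set. *)
Lemma progression_conv (p n L : nat) (S : {set 'I_p.+2}) : odd p ->
  (0 < n)%N -> (0 < L)%N -> ((5 * n * L) ^ (2 * n ^ 2) < p.+2)%N ->
  exists2 b : 'I_p.+2, b != 0 &
    (n * wcount (conv (fun j : 'I_L => b *+ j) S)
       <= L ^ 3 * (n * ap3count S + 4 * p.+2 ^ 2))%N.
Proof.
move=> podd n0 L0 hL; have [z zp] := C_prim_root_exists (ltn0Sn p.+1).
have [T [cT hT]] := simultaneous_bin zp (spectrum z S n) (2 * n * L).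
have : (1 < #|T|)%N.
  rewrite ltnNge; apply: contraL hL => T1; rewrite -leqNgt.
  apply: leq_trans cT _; apply: leq_trans (leq_mul (leqnn _) T1) _.
  rewrite muln1 expnM; apply: leq_trans (_ : (((2 * (2 * n * L)).+1 ^ 2) ^ (n ^ 2) <= _)%N).
    rewrite leq_exp2l ?(card_spectrum zp podd) //.
    by rewrite -[1%N](exp1n 2) ltn_exp2r // ltnS; nia.
  by rewrite leq_exp2r ?expn_gt0 ?n0 // leq_exp2r //; nia.
case/card_gt1P=> t [t'] [tT t'T tt']; exists (t - t'); first by rewrite subr_eq0.
have := conv_approx zp n0 (S := S) (tau := fun j : 'I_L => (t - t') *+ j).
rewrite card_ord; apply=> a j aS.
have := hT _ _ tT t'T a aS.
have -> : chi z (a * ((t - t') *+ j)) = chi z (a * (t - t')) ^+ j.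
  elim: (nat_of_ord j) => [|k IH]; first by rewrite mulr0n mulr0 chi0 expr0.
  by rewrite mulrS mulrDr (chiD zp) IH exprS.
have := chi_norm zp (a * (t - t')).
set c := chi z _ => c1 cc.
have le : `|c ^+ j - 1| <= j%:R * `|c - 1|.
  rewrite subrX1 normrM mulrC ler_wpM2r //.
  apply: le_trans (ler_norm_sum _ _ _) _.
  rewrite (eq_bigr (fun _ => 1)) ?sumr_const ?card_ord //.
  by move=> i _; rewrite normrX c1 expr1n.
apply: le_trans (ler_wpM2l (ler0n _ _) le) _.
apply: le_trans (_ : n%:R * (L%:R * `|c - 1|) <= _).
  by rewrite ler_wpM2l ?ler0n // ler_wpM2r // ler_nat ltnW.
by move: cc; rewrite !natrM -!mulrA ger_pMr ?ltr0n.
Qed.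

(** * Varnavides' theorem *)

Section Shifts.
Variable p : nat.
Notation Z := 'I_p.+2.
Implicit Type S : {set Z}.

(** Half the size of the symmetric difference of [S] and its translate by [d]. *)
Definition escape S (d : Z) : nat := #|[set x in S | x - d \notin S]|.

Lemma escapeE S d : escape S d = (\sum_x (x \in S) * (x - d \notin S)%R)%N.
Proof.
rewrite /escape -sum1_card big_mkcond /=; apply: eq_bigr => x _.
by rewrite inE; case: (x \in S); case: (x - d \notin S).
Qed.

Lemma conv_le (J : finType) (tau : J -> Z) S x : (conv tau S x <= #|J|)%N.
Proof. by rewrite -sum1_card leq_sum // => j _; case: (_ \in _). Qed.

Lemma sum_conv (J : finType) (tau : J -> Z) S : (\sum_x conv tau S x = #|J| * #|S|)%N.
Proof.
rewrite /conv exchange_big /= -sum_nat_const; apply: eq_bigr => j _.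
rewrite (reindex_inj (addIr (tau j))) /= -sum1_card [RHS]big_mkcond /=.
by apply: eq_bigr => x _; rewrite addrK; case: (x \in S).
Qed.

(** Both sides count the triples of [x], [j], [j'] with [x - tau j] in [S] and [x - tau j'] outside.
    Thus [S] is nearly invariant under the differences of [tau] when [conv tau S] is nearly
    two-valued. *)
Lemma sum_escape (J : finType) (tau : J -> Z) S :
  (\sum_j \sum_j' escape S (tau j' - tau j)%R
   = \sum_x conv tau S x * (#|J| - conv tau S x))%N.
Proof.
have E x : (#|J| - conv tau S x = \sum_j (x - tau j \notin S)%R)%N.
  rewrite /conv -[X in (X - _)%N]sum1_card -sumnB //; last by move=> j _; case: (_ \in _).
  by apply: eq_bigr => j _; case: (_ \in _).
under [RHS]eq_bigr do rewrite E /conv big_distrl /=.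
rewrite [RHS]exchange_big /=; apply: eq_bigr => j _.
under [RHS]eq_bigr do rewrite big_distrr /=.
rewrite [RHS]exchange_big /=; apply: eq_bigr => j' _.
rewrite escapeE (reindex_inj (addIr (- tau j))) /=; apply: eq_bigr => x _.
by rewrite opprB addrA subrK.
Qed.

(** A point [x] of [S] starts a progression of difference [- d j] unless one of the two steps leaves
    [S]; each step does so for at most [escape S (d j)] points. *)
Lemma ap3count_shifts L (d : 'I_L -> Z) S : injective d ->
  (L * #|S| <= ap3count S + 2 * \sum_j escape S (d j))%N.
Proof.
move=> d_inj.
pose V := [set u : 'I_L * Z | [&& u.2 \in S, u.2 - d u.1 \in S & u.2 - d u.1 - d u.1 \in S]].
pose f (u : 'I_L * Z) := (u.2, u.2 - d u.1 - d u.1, u.2 - d u.1).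
have f_inj : injective f.
  move=> [j x] [j' x'] e.
  have e1 : x = x' := congr1 (fun w => w.1.1) e.
  have e2 : x - d j = x' - d j' := congr1 snd e.
  by move: e2; rewrite e1 => /addrI /oppr_inj /d_inj ->.
have VS : (#|V| <= ap3count S)%N.
  rewrite -(card_imset _ f_inj); apply/subset_leq_card/subsetP => u.
  case/imsetP=> -[j x]; rewrite inE /= => /and3P[xS x1 x2] ->.
  rewrite inE /= xS x1 x2 /= mul2n -addnn.
  set s := x - d j.
  have : x + (s - d j) = s + s by rewrite /s; ring.
  by move/(congr1 val) => /= ->.
apply: leq_trans (leq_add VS (leqnn _)).
have -> : (#|V| = \sum_j \sum_x [&& x \in S, x - d j \in S & x - d j - d j \in S]%R)%N.
  rewrite -sum1_card big_mkcond /= pair_bigA; apply: eq_bigr => -[j x] _ /=.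
  by rewrite inE /=; case: andP.
rewrite big_distrr -big_split /= -[X in (X * _)%N]card_ord -sum_nat_const leq_sum // => j _.
rewrite mul2n -addnn {2}escapeE escapeE.
rewrite [X in (_ <= _ + (_ + X))%N](reindex_inj (addIr (- d j))) /= -!big_split /=.
rewrite -sum1_card big_mkcond leq_sum // => x _.
by case: (x \in S); case: (x - d j \in S); case: (x - d j - d j \in S).
Qed.

End Shifts.

(** The constant [kappa] is uniform in the modulus, so progressions of quadratic number are forced,
    whereas the trivial ones number only [#|S|]. *)
Definition supersaturated (R : realType) (rho : R) : Prop :=
  exists2 kappa : R, 0 < kappa & forall p (S : {set 'I_p.+2}), odd p ->
    rho * p.+2%:R <= #|S|%:R -> kappa * p.+2%:R ^+ 2 <= (ap3count S)%:R.

Lemma supersaturated_full (R : realType) (rho : R) : 1 <= rho -> supersaturated rho.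
Proof.
move=> rho1; exists 1 => // p S podd hS.
have ST : S = setT.
  apply/eqP; rewrite eqEcard subsetT cardsT card_ord -(ler_nat R).
  by apply: le_trans hS; rewrite ler_peMl ?ler0n.
have := ap3count_shifts S (fun x y : 'I_p.+2 => id).
rewrite big1 ?muln0 ?addn0; last first.
  by move=> d _; apply/eqP; rewrite cards_eq0; apply/eqP/setP => x; rewrite ST !inE.
by rewrite ST cardsT card_ord -(ler_nat R) natrM mul1r expr2.
Qed.

(* If few points lie where the local density [g / L] of [S] exceeds [rho / 12],
   then [g] is nearly [L] times an indicator, so [S] is nearly invariant under
   the differences of [tau], each of which is then the common difference of
   about [#|S|] progressions. *)
Lemma supersaturated_step (R : realType) (rho : R) : 0 < rho ->
  supersaturated (rho * (13%:R / 12%:R)) -> supersaturated rho.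
Proof.
move=> r0 [k k0 hk].
pose del := rho / 12%:R; have del0 : 0 < del by rewrite divr_gt0 // ltr0n.
have dk0 : 0 < del ^+ 3 * k by rewrite mulr_gt0 // exprn_gt0.
(* This [n] makes the relative error [4 / n] of [dense_conv] at most half of [del ^+ 3 * k]. *)
pose n := (Num.truncn (8%:R / (del ^+ 3 * k))).+1.
have hn : 8%:R <= n%:R * (del ^+ 3 * k).
  rewrite -ler_pdivrMr // ltW //.
  by have /andP[] := truncn_itv (divr_ge0 (ler0n _ 8) (ltW dk0)).
pose C := (((4 * n).+1 ^ 2) ^ (n ^ 2))%N.
have C0 : (0 < C)%N by rewrite !expn_gt0.
exists (Num.min (del ^+ 3 * k / 2%:R) (rho / 2%:R / C%:R)).
  by rewrite lt_min !divr_gt0 ?ltr0n.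
move=> p S podd hS.
have [L [tau [tau_inj qL happ]]] := dense_conv S podd (ltn0Sn _ : (0 < n)%N).
set q : R := p.+2%:R; have q0 : 0 < q by rewrite ltr0n.
have L0 : (0 < L)%N by case: L tau tau_inj qL happ => //; rewrite muln0.
have L0' : 0 < L%:R :> R by rewrite ltr0n.
pose g := conv tau S.
pose A := [set x | del * L%:R <= (g x)%:R].
(* If [A] has the increased density, its progressions weigh at least [(del * L) ^ 3] each in
   [wcount g], and [dense_conv] passes this on to [S]. *)
have [big|small] := leP (rho * (13%:R / 12%:R) * q) (#|A|%:R : R).
  apply: le_trans (_ : del ^+ 3 * k / 2%:R * q ^+ 2 <= _).
    by rewrite ler_wpM2r ?exprn_ge0 ?(ltW q0) // ge_min lexx.
  have hA := hk p A podd big.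
  have wA : (del * L%:R) ^+ 3 * (ap3count A)%:R <= (wcount g)%:R.
    apply: wcount_ge => [|x]; first by rewrite mulr_ge0 ?ltW.
    by rewrite inE.
  move: happ; rewrite -(ler_nat R) !(natrM, natrD, natrX) -/q -/g => happ.
  have L3 : 0 < L%:R ^+ 3 :> R by rewrite exprn_gt0.
  have n0 : 0 < n%:R :> R by rewrite ltr0n.
  have w2 : n%:R * (del ^+ 3 * k * q ^+ 2) <= n%:R * (ap3count S)%:R + 4%:R * q ^+ 2.
    rewrite -(ler_pM2l L3); apply: le_trans happ.
    rewrite mulrCA ler_pM2l //; apply: le_trans wA.
    have -> : (del * L%:R) ^+ 3 * (ap3count A)%:R =
      L%:R ^+ 3 * (del ^+ 3 * (ap3count A)%:R) by ring.
    by rewrite ler_pM2l // -mulrA ler_wpM2l ?exprn_ge0 // ltW.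
  rewrite -(ler_pM2l n0).
  have h8 := ler_wpM2r (exprn_ge0 2 (ltW q0)) hn.
  lra.
apply: le_trans (_ : rho / 2%:R / C%:R * q ^+ 2 <= _).
  by rewrite ler_wpM2r ?exprn_ge0 ?(ltW q0) // ge_min lexx orbT.
(* On [A] this follows from [g x <= L], off [A] from [g x <= del * L]. *)
have pt x : ((g x * (L - g x))%N)%:R <= L%:R * (L%:R * (x \in A)%:R - (g x)%:R + 2%:R * del * L%:R).
  have gL : (g x <= L)%N by rewrite -[leqRHS]card_ord conv_le.
  rewrite natrM natrB //.
  have g0 : 0 <= (g x)%:R :> R by rewrite ler0n.
  have gL' : (g x)%:R <= L%:R :> R by rewrite ler_nat.
  have sq : 0 <= ((g x)%:R - L%:R : R) ^+ 2 by exact: sqr_ge0.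
  have dL : 0 <= del * L%:R ^+ 2 by rewrite mulr_ge0 ?exprn_ge0 ?ltW.
  rewrite inE; case hx: (del * L%:R <= _) => /=; first by nra.
  move/negbT: hx; rewrite -ltNge => /ltW /(ler_wpM2l (ltW L0')) hx.
  move: hx (sqr_ge0 ((g x)%:R : R)); nra.
have sumg : (\sum_x (g x * (L - g x)))%N%:R <= L%:R ^+ 2 * #|S|%:R / 4%:R :> R.
  rewrite natr_sum; apply: le_trans (ler_sum _ (fun x _ => pt x)) _.
  rewrite -mulr_sumr big_split sumrB /= sumr_const card_ord -mulr_sumr.
  rewrite -!natr_sum sum_conv card_ord.
  have -> : (\sum_x (x \in A) = #|A|)%N.
    by rewrite -sum1_card [RHS]big_mkcond; apply: eq_bigr => x _; case: (x \in A).
  rewrite -(mulr_natr (2%:R * del * L%:R)) -/q natrM.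
  (* The choice of the constants: [13/12 - 1 + 2/12 = 1/4]. *)
  have X : #|A|%:R - #|S|%:R + 2%:R * del * q <= #|S|%:R / 4%:R by rewrite /del; lra.
  have -> : L%:R * (L%:R * #|A|%:R - L%:R * #|S|%:R + 2%:R * del * L%:R * q) =
    L%:R ^+ 2 * (#|A|%:R - #|S|%:R + 2%:R * del * q) by ring.
  by rewrite -[leRHS]mulrA ler_wpM2l // exprn_ge0 // ltW.
(* For each base point [j], the differences [tau j' - tau j] are distinct; summing over [j] brings
   in [sum_escape]. *)
have : (\sum_(j < L) L * #|S| <= \sum_(j < L) (ap3count S + 2 * \sum_j' escape S (tau j' - tau j)%R))%N.
  apply: leq_sum => j _; apply: (ap3count_shifts (d := fun j' => tau j' - tau j)).
  by move=> i i' /addIr /tau_inj.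
rewrite big_split /= -[X in (_ <= _ + X)%N]big_distrr /= sum_escape !sum_nat_const !card_ord.
rewrite -(ler_nat R) !(natrD, natrM) => le1.
have le2 : L%:R * #|S|%:R / 2%:R <= (ap3count S)%:R :> R.
  by rewrite -(ler_pM2l L0'); move: le1 sumg; rewrite -/g; lra.
apply: le_trans le2.
have qL' : q / C%:R <= L%:R by rewrite ler_pdivrMr ?ltr0n // mulrC -natrM ler_nat.
have -> : rho / 2%:R / C%:R * q ^+ 2 = (q / C%:R) * (rho * q) / 2%:R by field; rewrite pnatr_eq0 -lt0n.
rewrite ler_wpM2r ?invr_ge0 ?ler0n // ler_pM // ?mulr_ge0 ?invr_ge0 ?ler0n //; exact: ltW.
Qed.

Lemma bernoulli_lower (R : realFieldType) (x : R) (i : nat) : 0 <= x ->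
  1 + i%:R * x <= (1 + x) ^+ i.
Proof.
move=> x0; elim: i => [|i IH]; first by rewrite expr0 mul0r addr0.
rewrite exprS -natr1; have : 0 <= i%:R :> R by [].
move: IH; set e := _ ^+ i => IH i0; have := ler_wpM2l (_ : 0 <= 1 + x) IH.
rewrite addr_ge0 // => /(_ isT); have : 0 <= i%:R * (x * x) by rewrite !mulr_ge0.
lra.
Qed.

(** Induction on the number of increments by [13/12] that lift the density to 1. *)
Lemma supersaturation (R : realType) (rho : R) : 0 < rho -> supersaturated rho.
Proof.
move=> r0; have [N hN] : exists N, 1 <= rho * (13%:R / 12%:R) ^+ N.
  pose N := (Num.truncn (12%:R / rho)).+1; exists N.
  have b : 12%:R / rho <= N%:R.
    by have /andP[_ /ltW] := truncn_itv (divr_ge0 (ler0n _ 12) (ltW r0)).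
  have -> : 13%:R / 12%:R = 1 + 12%:R^-1 :> R by field.
  apply: le_trans (ler_wpM2l (ltW r0) (bernoulli_lower N (_ : 0 <= 12%:R^-1))); last by rewrite invr_ge0.
  by move: b; rewrite ler_pdivrMr //; lra.
elim: N rho r0 hN => [|N IH] rho r0; first by rewrite expr0 mulr1; exact: supersaturated_full.
rewrite exprS mulrA => hN; apply: supersaturated_step => //.
by apply: IH; rewrite // mulr_gt0 // divr_gt0 ?ltr0n.
Qed.

(** * Behrend's construction *)

Lemma digits_inj (B D : nat) (u v : nat -> nat) :
  (forall i, u i < B)%N -> (forall i, v i < B)%N ->
  (\sum_(i < D) u i * B ^ i = \sum_(i < D) v i * B ^ i)%N ->
  forall i, (i < D)%N -> u i = v i.
Proof.
elim: D u v => [|D IH] u v uB vB //.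
have E (w : nat -> nat) : (\sum_(i < D.+1) w i * B ^ i = (\sum_(i < D) w i.+1 * B ^ i) * B + w 0)%N.
  rewrite big_ord_recl muln1 addnC big_distrl /=; congr (_ + _)%N.
  by apply: eq_bigr => i _; rewrite /bump add1n expnSr mulnA.
rewrite !E => e; have B0 : (0 < B)%N by apply: leq_trans (uB 0%N).
have e0 : u 0%N = v 0%N.
  by have := congr1 (modn^~ B) e; rewrite /= !modnMDl !modn_small.
have e1 : (\sum_(i < D) u i.+1 * B ^ i = \sum_(i < D) v i.+1 * B ^ i)%N.
  by move/eqP: e; rewrite e0 eqn_add2r eqn_pmul2r // => /eqP.
move=> [//|i]; rewrite ltnS => iD.
by apply: (IH (fun i => u i.+1) (fun i => v i.+1)).
Qed.

Section Behrend.
Variables d D : nat.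
Notation T := {ffun 'I_D -> 'I_d}.

Definition encode (x : T) : nat := (\sum_i x i * (2 * d) ^ i)%N.
Definition sqnorm (x : T) : nat := (\sum_i x i ^ 2)%N.

Lemma encode_lt (x : T) : (encode x < (2 * d) ^ D)%N.
Proof.
rewrite /encode; elim: D x => [|k IH] x; first by rewrite big_ord0.
have := IH [ffun i => x (widen_ord (leqnSn k) i)].
rewrite big_ord_recr /=; under eq_bigr do rewrite ffunE /=.
move=> h; rewrite expnS.
have := ltn_ord (x ord_max); set X := nat_of_ord (x _) => Xd.
apply: leq_trans (_ : (2 * d) ^ k + X * (2 * d) ^ k <= _)%N.
  by rewrite ltn_add2r.
by rewrite -mulSn leq_mul2r; apply/orP; right; lia.
Qed.

(* Digits below [d] in base [2 d] add without carry, and a sphere is strictly convex. *)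
Lemma encode_midpoint (x y z : T) : sqnorm x = sqnorm z -> sqnorm y = sqnorm z ->
  (encode x + encode y = 2 * encode z)%N -> x = z /\ y = z.
Proof.
move=> xz yz e.
have mid i : (x i + y i = 2 * z i)%N.
  have d0 : (0 < d)%N by apply: leq_trans (ltn_ord (x i)).
  (* [digits_inj] expects digits indexed by [nat]; the default digit is 0. *)
  pose dig (w : 'I_D -> nat) k := if insub k is Some i then w i else 0%N.
  have digE w (j : 'I_D) : dig w j = w j by rewrite /dig valK.
  have := @digits_inj (2 * d) D (dig (fun j => x j + y j)%N) (dig (fun j => 2 * z j)%N).
  move=> /(_ _ _ _ i (ltn_ord i)); rewrite !digE; apply.
  - move=> k; rewrite /dig; case: insub => [j|]; last by lia.
    by have := ltn_ord (x j); have := ltn_ord (y j); lia.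
  - move=> k; rewrite /dig; case: insub => [j|]; last by lia.
    by have := ltn_ord (z j); lia.
  under eq_bigr do rewrite digE mulnDl.
  under [RHS]eq_bigr do rewrite digE -mulnA.
  by rewrite big_split -big_distrr.
(* The parallelogram identity at a midpoint [c], in truncated subtraction: one of [a - c] and
   [c - a] vanishes. *)
have sq a b c : (a + b = 2 * c)%N ->
    ((a - c) ^ 2 + (c - a) ^ 2 + ((a - c) ^ 2 + (c - a) ^ 2) + (c ^ 2 + c ^ 2) = a ^ 2 + b ^ 2)%N.
  have [/subnKC <-|/ltnW /subnKC <-] := leqP a c; move: (_ - _)%N => k e'.
    have -> : b = (a + 2 * k)%N by lia.
    by rewrite addKn subnDA subnn sub0n; ring.
  have [e1 e2] : c = (b + k)%N /\ (c - (c + k) = 0)%N by lia.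
  by rewrite addKn e2 e1; ring.
have : (\sum_i ((x i - z i) ^ 2 + (z i - x i) ^ 2) = 0)%N.
  have := eq_bigr _ (fun i _ => sq _ _ _ (mid i)) : (\sum_i _ = \sum_i _)%N.
  by rewrite !big_split /= -/(sqnorm x) -/(sqnorm y) -/(sqnorm z) xz yz; lia.
move/eqP; rewrite sum_nat_eq0 => /forallP h.
have xe : x = z.
  apply/ffunP => i; apply: val_inj; have := h i.
  by rewrite /= addn_eq0 !expn_eq0 !subn_eq0 !andbT => /andP[xz' zx']; apply/eqP; rewrite eqn_leq xz' zx'.
split=> //; apply/ffunP => i; apply: val_inj; have := mid i; rewrite xe /=; lia.
Qed.

Lemma encode_inj : injective encode.
Proof.
move=> x z e; apply/ffunP => i; apply: val_inj => /=.
have d0 : (0 < d)%N by apply: leq_trans (ltn_ord (x i)).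
pose dig (w : T) k := if insub k is Some i then nat_of_ord (w i) else 0%N.
have digE w (j : 'I_D) : dig w j = w j by rewrite /dig valK.
rewrite -!digE; apply: (@digits_inj (2 * d) D (dig x) (dig z)) => //.
- by move=> k; rewrite /dig; case: insub => [j|]; [have := ltn_ord (x j)|]; lia.
- by move=> k; rewrite /dig; case: insub => [j|]; [have := ltn_ord (z j)|]; lia.
by under eq_bigr do rewrite digE; under [RHS]eq_bigr do rewrite digE.
Qed.

Lemma large_sphere : (0 < d)%N -> (0 < D)%N ->
  exists r, (d ^ D <= (D * d ^ 2) * #|[set x : T | sqnorm x == r]|)%N.
Proof.
move=> d0 D0.
have lt (x : T) : (sqnorm x < D * d ^ 2)%N.
  apply: leq_trans (_ : (\sum_(i < D) (x i ^ 2).+1 <= _)%N).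
    rewrite /sqnorm -(prednK D0) in x *.
    rewrite [X in (X < _)%N]big_ord_recr [X in (_ <= X)%N]big_ord_recr /= addnS ltnS leq_add2r.
    by apply: leq_sum => i _.
  apply: leq_trans (_ : (\sum_(i < D) d ^ 2 <= _)%N); last by rewrite sum_nat_const card_ord.
  by apply: leq_sum => i _; rewrite ltn_exp2r.
have [|r hr] := @pigeonhole T _ (fun x => Ordinal (lt x)).
  by rewrite card_ffun !card_ord expn_gt0 d0.
exists (r : nat); move: hr; rewrite card_ffun !card_ord.
suff -> : [set t | Ordinal (lt t) == r] = [set x | sqnorm x == r] by [].
by apply/setP => x; rewrite !inE.
Qed.

End Behrend.

(** Each code on a sphere is blown up to an interval of length [w], so the density does not decay
    with the modulus. Blocks of width [2 * w] leave room for a sum of two offsets, and all elements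
    lie below half the modulus, so nothing wraps around. Every progression then stays within one
    block. *)
Lemma behrend_blowup (d D p w : nat) : (0 < d)%N -> (0 < D)%N -> odd p ->
  (4 * (2 * d) ^ D * w <= p.+2)%N ->
  exists S : {set 'I_p.+2}, (d ^ D * w <= D * d ^ 2 * #|S|)%N /\
    (ap3count S <= (2 * d) ^ D * w ^ 2)%N.
Proof.
move=> d0 D0 podd hw; have [r hr] := large_sphere d0 D0.
pose A := [set x : {ffun 'I_D -> 'I_d} | sqnorm x == r].
pose f (x : {ffun 'I_D -> 'I_d}) (u : nat) := (encode x * (2 * w) + u)%N.
have flt x u : (u < w)%N -> (2 * f x u < p.+2)%N.
  move=> uw; apply: leq_trans hw.
  by have := encode_lt x; rewrite /f; move: (_ ^ _)%N (encode _) => m a; nia.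
have fI x y u v : (u < 2 * w)%N -> (v < 2 * w)%N -> f x u = f y v -> x = y /\ u = v.
  move=> uw vw e; have w0 : (0 < 2 * w)%N by lia.
  split; last by have := congr1 (modn^~ (2 * w)%N) e; rewrite /= !modnMDl !modn_small.
  apply: encode_inj; have := congr1 (divn^~ (2 * w)%N) e.
  by rewrite /= !divnMDl // !divn_small ?addn0.
pose F (u : {ffun 'I_D -> 'I_d} * 'I_w) : 'I_p.+2 := inord (f u.1 u.2).
have FE u : F u = f u.1 u.2 :> nat by rewrite inordK //; have := flt u.1 u.2 (ltn_ord _); lia.
exists (F @: setX A [set: 'I_w]); split.
  rewrite card_imset ?cardsX ?cardsT ?card_ord; first by rewrite [leqRHS]mulnA leq_mul2r hr orbT.
  move=> [x u] [y v] /(congr1 val) /=; rewrite !FE /= => e.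
  have ltu (k : 'I_w) : (k < 2 * w)%N by have := ltn_ord k; lia.
  by have [-> /val_inj ->] := fI _ _ _ _ (ltu _) (ltu _) e.
(* A progression is determined by its block and its two outer offsets. *)
pose H (u : {ffun 'I_D -> 'I_d} * 'I_w * 'I_w) : 'I_p.+2 * 'I_p.+2 * 'I_p.+2 :=
  (inord (f u.1.1 u.1.2), inord (f u.1.1 u.2), inord (f u.1.1 (u.1.2 + u.2)./2)).
rewrite /ap3count; set V := [set _ | _].
apply: leq_trans (_ : #|H @: [set: {ffun 'I_D -> 'I_d} * 'I_w * 'I_w]| <= _)%N; last first.
  apply: leq_trans (leq_imset_card _ _) _.
  rewrite cardsT !card_prod card_ffun !card_ord -mulnA leq_mul2r; apply/orP; right.
  by rewrite leq_exp2r //; lia.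
apply/subset_leq_card/subsetP => -[[a b] c]; rewrite inE /= => /and4P[].
case/imsetP=> -[x u]; rewrite !inE /= andbT => /eqP xr ->.
case/imsetP=> -[y v]; rewrite !inE /= andbT => /eqP yr ->.
case/imsetP=> -[z t]; rewrite !inE /= andbT => /eqP zr ->.
rewrite !FE /=; have fx := flt x u (ltn_ord u).
have fy := flt y v (ltn_ord v); have fz := flt z t (ltn_ord t).
rewrite !modn_small; [|lia|lia] => /eqP e.
have e' : (f (x) 0 + f y 0 + (u + v) = 2 * f z 0 + 2 * t)%N by move: e; rewrite /f; lia.
have w0 : (0 < 2 * w)%N by have := ltn_ord u; lia.
have uv : (u + v < 2 * w)%N by have := ltn_ord u; have := ltn_ord v; lia.
have t2 : (2 * t < 2 * w)%N by have := ltn_ord t; lia.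
have e2 : ((encode x + encode y) * (2 * w) + (u + v) = 2 * encode z * (2 * w) + 2 * t)%N.
  by move: e'; rewrite /f !addn0 mulnDl -mulnA.
have tt : (u + v = 2 * t)%N.
  by have := congr1 (modn^~ (2 * w)%N) e2; rewrite /= !modnMDl !modn_small.
have ez : (encode x + encode y = 2 * encode z)%N.
  have := congr1 (divn^~ (2 * w)%N) e2.
  by rewrite /= !divnMDl // (divn_small uv) (divn_small t2) !addn0.
have [xz yz] := encode_midpoint (etrans xr (esym zr)) (etrans yr (esym zr)) ez.
apply/imsetP; exists (z, u, v); first by rewrite inE.
by rewrite xz yz /F /H /= tt mul2n doubleK.
Qed.

(** With [d = 2 ^ D] the density loses an exponent linear in [D] while the count gains a quadratic
    one; this will beat the weights [4096 ^ m]. *)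
Lemma behrend (D : nat) : (0 < D)%N ->
  exists N, forall p, odd p -> (N <= p)%N -> exists S : {set 'I_p.+2},
    (p.+2 <= 2 ^ (10 * D) * #|S|)%N /\ (2 ^ (D ^ 2) * ap3count S <= p.+2 ^ 2)%N.
Proof.
move=> D0; pose d := (2 ^ D)%N; pose m := ((2 * d) ^ D)%N.
have d0 : (0 < d)%N by rewrite expn_gt0.
have m0 : (0 < m)%N by rewrite expn_gt0 muln_gt0 d0.
exists (4 * m)%N => p podd hp; pose w := (p.+2 %/ (4 * m))%N.
have hw : (4 * m * w <= p.+2)%N by rewrite mulnC leq_trunc_div.
have w0 : (0 < w)%N by rewrite divn_gt0; lia.
have [S [hS ap]] := behrend_blowup d0 D0 podd hw; exists S; split.
  (* As [w] is positive, rounding it down costs at most a factor 2. *)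
  apply: leq_trans (_ : 8 * m * w <= _)%N.
    have := ltn_ceil p.+2 (_ : 0 < 4 * m)%N; rewrite -/w => /(_ ltac:(lia)).
    by clear -w0 m0; nia.
  have -> : (8 * m * w = 8 * 2 ^ D * (d ^ D * w))%N by rewrite /m expnMn; ring.
  apply: leq_trans (leq_mul (leqnn _) hS) _.
  have -> : (8 * 2 ^ D * (D * d ^ 2 * #|S|) = 8 * 2 ^ D * D * d ^ 2 * #|S|)%N by ring.
  rewrite leq_mul2r; apply/orP; right.
  apply: leq_trans (_ : 8 * 2 ^ D * d * d ^ 2 <= _)%N.
    by rewrite leq_mul2r leq_mul2l ltnW ?orbT // ltn_expl.
  rewrite /d -!expnM -[8%N]/(2 ^ 3)%N -!expnD leq_exp2l //; lia.
apply: leq_trans (_ : m * ap3count S <= _)%N.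
  rewrite leq_mul2r; apply/orP; right.
  rewrite /m /d -expnS -expnM leq_exp2l //; lia.
apply: leq_trans (_ : (4 * m * w) ^ 2 <= _)%N; last by rewrite leq_exp2r.
apply: leq_trans (leq_mul (leqnn m) ap) _; rewrite -/m.
have -> : ((4 * m * w) ^ 2 = 16 * (m * (m * w ^ 2)))%N by ring.
by lia.
Qed.

(** * Concentration of the convolution *)

(** Telescoping: [1 / b <= 2 * (b - a)] for consecutive roots [a], [b] amounts to
    [(a - b) ^+ 2 >= 0]. *)
Lemma sum_inv_sqrt (R : rcfType) (L : nat) :
  \sum_(j < L) (Num.sqrt j.+1%:R)^-1 <= 2%:R * Num.sqrt L%:R :> R.
Proof.
elim: L => [|L IH]; first by rewrite big_ord0 mulr_ge0 ?sqrtr_ge0.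
rewrite big_ord_recr /=; apply: le_trans (lerD IH (lexx _)) _.
set a := Num.sqrt L%:R; set b := Num.sqrt L.+1%:R.
have b0 : 0 < b by rewrite sqrtr_gt0 ltr0n.
have a2 : a ^+ 2 = L%:R by rewrite sqr_sqrtr ?ler0n.
have b2 : b ^+ 2 = L%:R + 1 by rewrite sqr_sqrtr ?ler0n // natr1.
have bV : b * b^-1 = 1 by rewrite divff ?gt_eqF.
rewrite -(ler_pM2l b0) mulrDr bV.
by have := sqr_ge0 (a - b); nra.
Qed.

Lemma sum_minn (I : finType) (f : I -> nat) (L : nat) :
  (\sum_x minn (f x) L = \sum_(j < L) #|[set x | (j < f x)%N]|)%N.
Proof.
under [RHS]eq_bigr do rewrite -sum1_card big_mkcond.
rewrite exchange_big /=; apply: eq_bigr => x _.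
under eq_bigr do rewrite inE.
elim: L => [|L IH]; first by rewrite big_ord0 minn0.
rewrite big_ord_recr /= -IH; case: ltnP => h; lia.
Qed.

(** The chord bound for a convex function on [[0, 1]]. *)
Lemma bernoulli_upper (R : realFieldType) (x : R) (i : nat) : 0 <= x <= 1 ->
  (1 + x) ^+ i <= 1 + (2%:R ^+ i - 1) * x.
Proof.
case/andP=> x0 x1; elim: i => [|i IH]; first by rewrite !expr0; lra.
rewrite !exprS; have p1 : 1 <= 2%:R ^+ i :> R by rewrite exprn_ege1 // ler1n.
apply: le_trans (ler_wpM2l (_ : 0 <= 1 + x) IH) _; first by lra.
set e := _ ^+ i in p1 *; have : 0 <= (e - 1) * (x * (1 - x)).
  by rewrite !mulr_ge0 // subr_ge0.
by lra.
Qed.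

Section Concentration.
Variables (R : realType) (p L K : nat) (tau : 'I_L -> 'I_p.+2) (S : {set 'I_p.+2}) (rho : R).
Hypotheses (K0 : (0 < K)%N) (rho0 : 0 <= rho) (ap0 : (0 < ap3count S)%N).
Hypothesis few : (wcount (conv tau S) <= 2 * L ^ 3 * ap3count S)%N.
Hypothesis growth : forall i (W : {set 'I_p.+2}),
  rho * (1 + K%:R^-1) ^+ i * p.+2%:R <= #|W|%:R -> (16 ^ (3 * i) * ap3count S <= ap3count W)%N.
Hypothesis dense : rho * p.+2%:R <= #|S|%:R.

(** By [wcount_ge] and [few], the level set has at most [16 * (L / j.+1) ^ 3] times as many
    progressions as [S]; [growth] turns this into a bound on its size. *)
Lemma card_level (j : 'I_L) :
  #|[set x | (j < 2 * conv tau S x)%N]|%:R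
  <= rho * p.+2%:R * (1 + 8%:R / K%:R * Num.sqrt L%:R * (Num.sqrt j.+1%:R)^-1).
Proof.
set W := [set x | _]; have jL := ltn_ord j.
(* The least such [i] is positive since [j < L]. It is large enough for [growth] to give a
   contradiction, as [4 ^ 3 > 16], and its minimality bounds [2 ^ i] by a multiple of
   [sqrt (L / j.+1)]. *)
have ex : exists i, (4 * L <= 16 ^ i * j.+1)%N.
  exists (4 * L)%N; apply: leq_trans (ltnW (ltn_expl _ (_ : 1 < 16)%N)) _ => //.
  by rewrite leq_pmulr.
case: (ex_minnP ex) => -[|i] hi imin; first by lia.
have {imin} hi' : (16 ^ i * j.+1 < 4 * L)%N.
  by rewrite ltnNge; apply: contraTN (ltnSn i) => /imin; rewrite -leqNgt.
have W_lt : (#|W|%:R <= rho * (1 + K%:R^-1) ^+ i.+1 * p.+2%:R).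
  rewrite leNgt; apply/negP => /ltW /growth hW.
  have h : (j.+1%:R / 2%:R) ^+ 3 * (ap3count W)%:R <= (wcount (conv tau S))%:R :> R.
    apply: wcount_ge => [|x]; first by rewrite divr_ge0 ?ler0n.
    by rewrite inE -(ler_nat R) natrM; lra.
  have {}h : (j.+1 ^ 3 * ap3count W <= 16 * L ^ 3 * ap3count S)%N.
    rewrite -(ler_nat R) !(natrX, natrM); move: few; rewrite -(ler_nat R) !(natrX, natrM) => few'.
    have := le_trans h few'; rewrite expr_div_n; set a := ap3count W; set b := ap3count S.
    by have -> : 2%:R ^+ 3 = 8%:R :> R; [rewrite -natrX | lra].
  have : (j.+1 ^ 3 * (16 ^ (3 * i.+1) * ap3count S) <= 16 * L ^ 3 * ap3count S)%N.
    by apply: leq_trans h; rewrite leq_mul2l hW orbT.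
  rewrite mulnA leq_pmul2r // leqNgt => /negP; apply.
  have -> : (j.+1 ^ 3 * 16 ^ (3 * i.+1) = (16 ^ i.+1 * j.+1) ^ 3)%N.
    by rewrite (mulnC 3) expnM expnMn mulnC.
  apply: leq_trans (_ : (4 * L) ^ 3 <= _)%N; last by rewrite leq_exp2r.
  rewrite expnMn ltn_pmul2r //; rewrite expn_gt0; lia.
apply: le_trans W_lt _; rewrite mulrAC ler_wpM2l ?mulr_ge0 ?ler0n //.
have KV : 0 <= (K%:R^-1 : R) <= 1 by rewrite invr_ge0 ler0n invf_le1 ?ltr0n // ler1n.
apply: le_trans (bernoulli_upper i.+1 KV) _; rewrite lerD2l.
apply: le_trans (_ : 2%:R ^+ i.+1 * K%:R^-1 <= _).
  by rewrite ler_wpM2r ?gerBl //; case/andP: KV.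
rewrite [8%:R / _]mulrC -!mulrA mulrC ler_wpM2l //; first by case/andP: KV.
have s0 : 0 < Num.sqrt j.+1%:R :> R by rewrite sqrtr_gt0 ltr0n.
rewrite mulrA ler_pdivlMr //.
rewrite -(@ler_pXn2r _ 2) ?nnegrE ?mulr_ge0 ?exprn_ge0 ?sqrtr_ge0 //.
rewrite !exprMn !sqr_sqrtr ?ler0n // -exprM mulnC exprM.
rewrite -natrX -[8%:R ^+ 2]natrX -!natrX -!natrM ler_nat.
apply: leq_trans (_ : 4 * (16 ^ i * j.+1) <= _)%N; last by lia.
by rewrite expnS -mulnA !leq_mul //; case: (i) => // k; rewrite leq_exp2r.
Qed.

(** By [card_level], the sum of [minn (2 * conv tau S x) L] hardly exceeds that of [conv tau S x],
    and [L] times the pointwise gap dominates the summand here. *)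
Lemma sum_conv_compl :
  (\sum_x conv tau S x * (L - conv tau S x))%N%:R <= 16%:R / K%:R * L%:R ^+ 2 * #|S|%:R :> R.
Proof.
have q0 : 0 <= rho * p.+2%:R by rewrite mulr_ge0.
have K16 : 0 <= 16%:R / K%:R :> R by rewrite divr_ge0.
have Lg x : (conv tau S x <= L)%N by rewrite -[leqRHS]card_ord conv_le.
have sum_le : (\sum_x minn (2 * conv tau S x) L)%N%:R <= rho * p.+2%:R * (L%:R * (1 + 16%:R / K%:R)).
  rewrite sum_minn natr_sum; apply: le_trans (ler_sum _ (fun j _ => card_level j)) _.
  rewrite -mulr_sumr ler_wpM2l // big_split /= sumr_const card_ord mulrDr mulr1 lerD2l.
  rewrite -mulr_sumr; apply: le_trans (ler_wpM2l _ (sum_inv_sqrt R L)) _.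
    by rewrite mulr_ge0 ?sqrtr_ge0 ?divr_ge0.
  rewrite le_eqVlt; apply/orP; left; apply/eqP.
  have -> : L%:R * (16%:R / K%:R) = Num.sqrt L%:R ^+ 2 * (16%:R / K%:R) :> R by rewrite sqr_sqrtr ?ler0n.
  by field; rewrite pnatr_eq0 -lt0n.
(* When [2 * conv tau S x > L], this is [(L - conv tau S x) ^ 2 >= 0]. *)
have pt x : ((conv tau S x * (L - conv tau S x))%N%:R + L%:R * (conv tau S x)%:R <=
    L%:R * (minn (2 * conv tau S x) L)%:R :> R).
  by rewrite -!natrM -natrD ler_nat; have := Lg x; case: leqP; nia.
have := ler_sum _ (fun x (_ : true) => pt x) : \sum_x _ <= \sum_x _.
rewrite big_split /= -!mulr_sumr -!natr_sum sum_conv card_ord natrM => le1.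
have L0 : 0 <= L%:R :> R by [].
have := ler_wpM2l L0 sum_le.
have := ler_wpM2r (_ : 0 <= L%:R * (L%:R * (1 + 16%:R / K%:R))) dense.
rewrite !mulr_ge0 ?addr_ge0 // => /(_ isT); lra.
Qed.

End Concentration.

(** * Near-invariance along a progression *)

Lemma escapeN p (S : {set 'I_p.+2}) (d : 'I_p.+2) : escape S (- d)%R = escape S d.
Proof.
have E e : (escape S e + \sum_x (x \in S) * (x - e \in S)%R = #|S|)%N.
  rewrite escapeE -big_split -sum1_card [RHS]big_mkcond /=; apply: eq_bigr => x _.
  by case: (x \in S); case: (x - e \in S).
apply/eqP; rewrite -(eqn_add2r (\sum_x (x \in S) * (x - d \in S)%R)) E -(E (- d)) eqn_add2l.
rewrite (reindex_inj (addIr d)) /=; apply/eqP/eq_bigr => x _.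
by rewrite addrK opprK mulnC.
Qed.

Lemma escapeD p (S : {set 'I_p.+2}) (d e : 'I_p.+2) : (escape S (d + e)%R <= escape S d + escape S e)%N.
Proof.
rewrite !escapeE [X in (_ <= _ + X)%N](reindex_inj (addIr (- d))) -big_split leq_sum //= => x _.
rewrite opprD addrA.
by case: (x \in S); case: (x - d \in S); case: (x - d - e \in S).
Qed.

(** Write [k] as [(j + k - i) - (j - i)], use the triangle inequality [escapeD], and average over
    all [i] and over [j < L - k], which is at least half of the range. *)
Lemma escape_multiple p (S : {set 'I_p.+2}) (b : 'I_p.+2) (L k : nat) : (2 * k <= L)%N ->
  (L ^ 2 * escape S (b *+ k)
    <= 4 * \sum_x conv (fun j : 'I_L => b *+ j) S x * (L - conv (fun j : 'I_L => b *+ j) S x))%N.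
Proof.
move=> kL; have := sum_escape (fun j : 'I_L => b *+ j) S; rewrite card_ord => <-.
pose E (i j : nat) := escape S (b *+ j - b *+ i)%R.
have tri i j : (escape S (b *+ k) <= E i (j + k)%N + E i j)%N.
  rewrite /E -[escape S (_ *+ j - _)]escapeN; apply: leq_trans (escapeD _ _ _).
  by rewrite mulrnDr; have -> : b *+ j + b *+ k - b *+ i - (b *+ j - b *+ i) = b *+ k by ring.
have row i : (L * escape S (b *+ k) <= 4 * \sum_(j < L) E i j)%N.
  apply: leq_trans (_ : 2 * \sum_(j < L - k) (E i (j + k)%N + E i j) <= _)%N.
    apply: leq_trans (_ : 2 * \sum_(j < L - k) escape S (b *+ k) <= _)%N.
      by rewrite sum_nat_const card_ord mulnA leq_mul2r; apply/orP; right; lia.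
    by rewrite leq_mul2l leq_sum.
  have -> : 4%N = (2 * 2)%N by [].
  rewrite -mulnA leq_mul2l /= big_split /= mulSn mul1n leq_add //.
    rewrite -(big_mkord xpredT (fun j => E i (j + k)%N)) -(big_mkord xpredT (E i)).
    rewrite [leqRHS](@big_cat_nat _ _ _ k) //=; last by lia.
    have -> : (\sum_(k <= j < L) E i j = \sum_(0 <= j < L - k) E i (j + k))%N.
      by rewrite -{1}[k]add0n big_addn.
    exact: leq_addl.
  rewrite -!(big_mkord xpredT (E i)) [leqRHS](@big_cat_nat _ _ _ (L - k)) //= ?leq_addr //; lia.
rewrite expnS expn1 -mulnA big_distrr /= -[X in (X * _)%N]card_ord -sum_nat_const.
by apply: leq_sum => i _; exact: row.
Qed.

(** * The minimal level *)

Lemma card_shift p (S : {set 'I_p.+2}) (b : 'I_p.+2) (j : nat) :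
  (#|S :&: shift S (b * j)| + escape S (b *+ j) = #|S|)%N.
Proof.
rewrite /escape -(cardsID (shift S (b * j)) S); congr (_ + _)%N.
apply: eq_card => x; rewrite in_setD andbC inE; congr (_ && ~~ _).
have E (s : 'I_p.+2) : ((x : nat) == (s + b * j) %% p.+2)%N = (x == s + b *+ j).
  have <- : (b * j)%N%:R = b *+ j by rewrite mulrnA natr_Zp.
  by rewrite -val_eqE Zp_nat /= modnDmr.
rewrite inE; apply/idP/existsP => [xS|[s /andP[sS]]].
  by exists (x - b *+ j); rewrite xS E subrK eqxx.
by rewrite E => /eqP ->; rewrite addrK.
Qed.

Lemma rq_le (R : realType) q (rho : R) (S : {set 'I_q}) :
  rho * q%:R <= #|S|%:R -> rq q rho <= mu R S.
Proof. by move=> hS; rewrite /rq (bigD1 S) //= ge_min lexx. Qed.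

Lemma le_rq (R : realType) q (rho c : R) : rho <= 1 ->
  (forall S : {set 'I_q}, rho * q%:R <= #|S|%:R -> c <= mu R S) -> c <= rq q rho.
Proof.
move=> rho1 h; rewrite /rq; elim/big_ind: _ => [|x y cx cy|S /h //].
  (* The default value of the minimum belongs to the full set, which is admissible as [rho <= 1]. *)
  by apply: h; rewrite cardsT card_ord ler_piMl.
by rewrite le_min cx.
Qed.

(** The minimising level depends on the prime, but the density must be fixed beforehand; one of the
    finitely many levels recurs infinitely often. *)
Lemma infinitely_often_le (P : nat -> nat -> Prop) (m : nat) :
  (forall N, exists q, (N < q)%N /\ exists2 i, (i <= m)%N & P i q) ->
  exists2 i, (i <= m)%N & forall N, exists q, (N < q)%N /\ P i q.
Proof.
elim: m => [|m IH] h.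
  exists 0%N => // N; have [q [Nq [i]]] := h N.
  by rewrite leqn0 => /eqP -> Pq; exists q.
have [top|/existsNP[N0 hN0]] := pselect (forall N, exists q, (N < q)%N /\ P m.+1 q).
  by exists m.+1.
have [|i im hi] := IH; last by exists i => //; exact: leqW.
move=> N; have [q [+ [i + Pq]]] := h (maxn N N0); rewrite gtn_max => /andP[Nq N0q].
rewrite leq_eqVlt => /predU1P[e|im]; last by exists q; split => //; exists i.
by case: hN0; exists q; rewrite -e.
Qed.

Section MinimalLevel.
Variables (R : realType) (K top : nat).
Hypothesis K0 : (0 < K)%N.

Definition level (m : nat) : R := (1 + K%:R^-1) ^- m.

Let KV0 : 0 < K%:R^-1 :> R. Proof. by rewrite invr_gt0 ltr0n. Qed.
Let lam1 : 1 < 1 + K%:R^-1 :> R. Proof. by rewrite ltrDl. Qed.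
Let lam0 : 0 < 1 + K%:R^-1 :> R. Proof. exact: lt_trans lam1. Qed.

Lemma level_gt0 m : 0 < level m.
Proof. by rewrite invr_gt0 exprn_gt0. Qed.

Lemma level_le1 m : level m <= 1.
Proof. by rewrite invf_le1 ?exprn_gt0 // exprn_ege1 // ltW. Qed.

Lemma level_anti m i : (i <= m)%N -> level m <= level i.
Proof. by move=> im; rewrite lef_pV2 ?posrE ?exprn_gt0 // ler_eXn2l. Qed.

Lemma levelD m i : level (m + i) * (1 + K%:R^-1) ^+ i = level m.
Proof.
by rewrite /level exprD invfM -mulrA mulVf ?mulr1 // expf_neq0 // gt_eqF.
Qed.

Lemma level_top (k : nat) : level (K * k) <= 2%:R ^- k.
Proof.
rewrite /level exprM lef_pV2 ?posrE ?exprn_gt0 ?ltr0n //.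
have e0 : 0 <= (1 + K%:R^-1 : R) ^+ K by rewrite exprn_ge0 // ltW.
apply: lerXn2r; rewrite ?nnegrE //.
apply: le_trans (bernoulli_lower _ (ltW KV0)).
by rewrite divff ?pnatr_eq0 -?lt0n.
Qed.

Lemma ln_level m : `|ln (level m)| <= m%:R / K%:R.
Proof.
rewrite /level lnV ?posrE ?exprn_gt0 // lnXn // normrN ger0_norm; last first.
  by rewrite mulrn_wge0 // ln_ge0 // ltW.
rewrite -[_ *+ m]mulr_natl ler_wpM2l // le_ln1Dx //.
by apply: lt_trans KV0; rewrite ltrN10.
Qed.

Lemma minimal_level p : exists2 m, (m <= top)%N &
  forall i, (i <= top)%N ->
  (16 ^ (3 * m))%N%:R * rq p.+2 (level m) <= (16 ^ (3 * i))%N%:R * rq p.+2 (level i).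
Proof.
pose F (i : 'I_top.+1) : R := (16 ^ (3 * i))%N%:R * rq p.+2 (level i).
have [m _ hm] := @Order.TotalTheory.arg_minP _ _ _ (@ord0 top) xpredT F isT.
exists m; first by rewrite -ltnS.
by move=> i im; exact: (hm (Ordinal (im : (i < top.+1)%N))).
Qed.

(** Compare level [m] with level [m - i], at which [W] is admissible. *)
Lemma minimal_growth p m (S : {set 'I_p.+2}) :
  (forall i, (i <= top)%N ->
  (16 ^ (3 * m))%N%:R * rq p.+2 (level m) <= (16 ^ (3 * i))%N%:R * rq p.+2 (level i)) ->
  (m <= top)%N -> mu R S = rq p.+2 (level m) ->
  forall i (W : {set 'I_p.+2}), level m * (1 + K%:R^-1) ^+ i * p.+2%:R <= #|W|%:R ->
    (16 ^ (3 * i) * ap3count S <= ap3count W)%N.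
Proof.
move=> hmin mtop Srq i W.
have q0 : 0 < p.+2%:R :> R by rewrite ltr0n.
have [im|mi] := leqP i m.
  rewrite -[in level m](subnK im) levelD => hW.
  have := hmin (m - i)%N (leq_trans (leq_subr _ _) mtop).
  have -> : (3 * m = 3 * (m - i) + 3 * i)%N by lia.
  rewrite expnD natrM -mulrA ler_pM2l ?ltr0n ?expn_gt0 //.
  move/le_trans/(_ (rq_le hW)); rewrite -Srq /mu mulrA ler_pM2r ?invr_gt0 ?ltr0n ?expn_gt0 //.
  by rewrite -natrM ler_nat.
(* For [i > m] the set [W] would have density above 1. *)
have -> : i = (m + (i - m))%N by lia.
rewrite exprD mulrA /level mulVf ?expf_neq0 ?gt_eqF // mul1r => hW.
have : (1 + K%:R^-1) ^+ (i - m) * p.+2%:R <= p.+2%:R :> R.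
  apply: le_trans hW _; rewrite ler_nat -[leqRHS]card_ord; exact: max_card.
rewrite ger_pMl // leNgt exprn_egt1 //; lia.
Qed.

End MinimalLevel.

(** The progression has length [2 * l] because [escape_multiple] reaches only half of it. The
    condition on [n * kap] makes the error of [progression_conv] at most the main term, which yields
    the factor 2 in [few]. The constant 64 is 4 from [escape_multiple] times 16 from
    [sum_conv_compl]. *)
Lemma near_invariant (R : realType) p (S : {set 'I_p.+2}) (K n m top l : nat) (kap : R) :
  odd p -> (0 < K)%N -> (0 < n)%N -> (0 < l)%N ->
  0 < kap -> 4%:R <= n%:R * kap -> kap * p.+2%:R ^+ 2 <= (ap3count S)%:R ->
  ((10 * n * l) ^ (2 * n ^ 2) < p.+2)%N ->
  (forall i, (i <= top)%N ->
  (16 ^ (3 * m))%N%:R * rq p.+2 (level R K m) <= (16 ^ (3 * i))%N%:R * rq p.+2 (level R K i)) ->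
  (m <= top)%N -> level R K m * p.+2%:R <= #|S|%:R -> mu R S = rq p.+2 (level R K m) ->
  exists2 b : 'I_p.+2, b != 0 & forall j, (j <= l)%N ->
    #|S|%:R * (1 - 64%:R / K%:R) <= #|S :&: shift S (b * j)|%:R :> R.
Proof.
move=> podd K0 n0 l0 kap0 nkap hap hl hmin mtop hS Srq.
have q0 : 0 < p.+2%:R :> R by rewrite ltr0n.
have L0 : (0 < 2 * l)%N by rewrite muln_gt0.
have [|b b0 hb] := progression_conv S podd n0 L0.
  by apply: leq_trans hl; rewrite (_ : 5 * n * (2 * l) = 10 * n * l)%N //; ring.
exists b => // j jl.
have ap0 : (0 < ap3count S)%N.
  by rewrite -(ltr_nat R); apply: lt_le_trans hap; rewrite mulr_gt0 ?exprn_gt0.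
have few : (wcount (conv (fun j : 'I_(2 * l) => b *+ j) S) <= 2 * (2 * l) ^ 3 * ap3count S)%N.
  rewrite -(leq_pmul2l n0); apply: leq_trans hb _.
  have -> : (n * (2 * (2 * l) ^ 3 * ap3count S) = (2 * l) ^ 3 * (n * ap3count S + n * ap3count S))%N.
    by ring.
  rewrite leq_mul2l leq_add2l -(ler_nat R) !(natrX, natrM); apply/orP; right.
  apply: le_trans (ler_wpM2l (ler0n R n) hap); rewrite [leRHS]mulrA.
  by rewrite ler_wpM2r ?exprn_ge0.
have gr := minimal_growth K0 hmin mtop Srq.
have := sum_conv_compl K0 (ltW (level_gt0 R K0 m)) ap0 few gr hS.
have := escape_multiple S b (_ : 2 * j <= 2 * l)%N; rewrite leq_mul2l jl orbT => /(_ isT).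
rewrite -(ler_nat R) !(natrX, natrM) => h1 h2.
have L2 : 0 < (2%:R * l%:R) ^+ 2 :> R by rewrite -natrM exprn_gt0 // ltr0n.
have {h2} h3 : (escape S (b *+ j))%:R <= 64%:R / K%:R * #|S|%:R :> R.
  rewrite -(ler_pM2l L2); apply: le_trans h1 _; lra.
rewrite -(card_shift S b j) natrD in h3 *; lra.
Qed.

Theorem theorem3 (R : realType) :
  (forall theta : R, 0 < theta -> exists x0 : R, forall x : R, x0 <= x ->
     exists p : nat, prime p /\ x <= p%:R <= x + x `^ theta) ->
  exists c : R, 0 < c /\
  forall rho0 : R, 0 < rho0 < 1 ->
  exists rho1 d : R, [/\ 0 < rho1, rho1 < rho0, 0 < d, d < 1 &
    forall N : nat, exists q : nat, (N < q)%N /\ prime q /\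
      forall S : {set 'I_q},
        rho1 * q%:R <= #|S|%:R -> mu R S = rq q rho1 ->
        exists b : nat, (0 < b < q)%N /\
          forall j : nat, j%:R <= q%:R `^ d ->
            #|S|%:R * (1 - c / `|ln rho1|) <= #|S :&: shift S (b * j)|%:R].
Proof.
(* [10 * C * K] is the exponent of the density in Behrend's construction, with
   [2 ^ (- (C * K) ^ 2)] many progressions; [120 * C * K ^ 2] is the exponent
   of [4096 ^ top]. *)
have [C hC] : exists C, (120 * C < C * C)%N by exists 121%N.
have C0 : (0 < C)%N by case: C hC.
move=> _; exists (64%:R * (10 * C)%N%:R); split; first by rewrite -natrM ltr0n !muln_gt0 C0.
move=> rho0 /andP[rho0_gt0 rho0_lt1].
have [kap0 kap0_gt0 hkap0] := supersaturation rho0_gt0.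
pose K := (Num.truncn kap0^-1).+1; pose top := (K * (10 * (C * K)))%N.
have KV : K%:R^-1 < kap0.
  rewrite -[kap0]invrK ltf_pV2 ?posrE ?invr_gt0 ?ltr0n //.
  have kapV : 0 <= kap0^-1 by rewrite invr_ge0 ltW.
  by have /andP[] := truncn_itv kapV.
(* Density is least at level [top], so [kap] serves all the levels considered. *)
have [kap kap_gt0 hkap] := supersaturation (level_gt0 R (ltn0Sn _ : (0 < K)%N) top).
pose n := (Num.truncn (4%:R / kap)).+1.
have nkap : 4%:R <= n%:R * kap.
  rewrite -ler_pdivrMr // ltW //.
  by have /andP[] := truncn_itv (divr_ge0 (ler0n R 4) (ltW kap_gt0)).
pose d : R := (4 * n ^ 2)%N%:R^-1.
have d0 : 0 < d by rewrite invr_gt0 ltr0n.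
pose P m q := [/\ prime q, level R K m < rho0 & forall S : {set 'I_q},
  level R K m * q%:R <= #|S|%:R -> mu R S = rq q (level R K m) ->
  exists b : nat, (0 < b < q)%N /\ forall j : nat, j%:R <= q%:R `^ d ->
    #|S|%:R * (1 - 64%:R / K%:R) <= #|S :&: shift S (b * j)|%:R :> R].
have [|N1 hN1] := behrend (_ : 0 < C * K)%N; first by rewrite muln_gt0 C0.
have [|m mtop hm] := @infinitely_often_le P top.
  move=> N; have [q hq q_prime] := prime_above (N + N1 + (10 * n) ^ (4 * n ^ 2) + 2).
  have [Nq N1q nq] : [/\ N < q, N1 + 2 < q & (10 * n) ^ (4 * n ^ 2) < q]%N.
    by move: hq; move: ((10 * n) ^ _)%N => E; clear; split; lia.
  exists q; split => //.
  have [p pq] : exists p, q = p.+2 by exists q.-2; rewrite -[LHS](subnKC (_ : 2 <= q)%N) ?subn2 ?prime_gt1.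
  have podd : odd p.
    by case: (even_prime q_prime) N1q; rewrite pq /= ?negbK // => -[->]; rewrite addn2.
  have q0 : 0 < p.+2%:R :> R by rewrite ltr0n.
  have Q0 : 0 < (p.+2 ^ 2)%N%:R :> R by rewrite ltr0n.
  clear hq; rewrite {q}pq in nq N1q Nq q_prime *.
  have [m mtop hmin] := minimal_level R K top p.
  exists m => //; split => //.
    (* Otherwise [rq] at level [m] is at least [kap0], whereas minimality against level [top] and
       Behrend's set make it at most [2 ^ - K < 1 / K < kap0]. *)
    rewrite ltNge; apply/negP => rho0_le.
    have kap_le : kap0 <= rq p.+2 (level R K m).
      apply: le_rq (level_le1 R _ m) _ => // S hS.
      rewrite /mu ler_pdivlMr // natrX; apply: hkap0 => //.
      by apply: le_trans hS; rewrite ler_wpM2r.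
    have [|B [hB apB]] := hN1 p podd; first by move: N1q; rewrite addn2 !ltnS => /ltnW.
    have B_dense : level R K top * p.+2%:R <= #|B|%:R.
      apply: le_trans (ler_wpM2r (ltW q0) (level_top R _ _)) _ => //.
      by rewrite ler_pdivrMl ?exprn_gt0 ?ltr0n // -natrX -natrM ler_nat.
    have := le_trans (hmin top (leqnn _)) (ler_wpM2l (ler0n _ _) (rq_le B_dense)).
    apply/negP; rewrite -ltNge; apply: lt_le_trans (_ : kap0 <= _); last first.
      have rq0 := le_trans (ltW kap0_gt0) kap_le.
      by apply: le_trans kap_le _; rewrite ler_peMl // ler1n expn_gt0.
    apply: le_lt_trans KV.
    rewrite /mu mulrA ler_pdivrMr // ler_pdivlMl ?ltr0n //.
    rewrite -!natrM ler_nat.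
    apply: leq_trans apB; rewrite mulnA leq_mul2r; apply/orP; right.
    have -> : (16 ^ (3 * top) = 2 ^ (12 * top))%N by rewrite -[16%N]/(2 ^ 4)%N -expnM mulnA.
    apply: leq_trans (_ : 2 ^ K * 2 ^ (12 * top) <= _)%N; first by rewrite leq_mul2r ltnW ?orbT // ltn_expl.
    rewrite -expnD leq_exp2l // /top; move: (ltn0Sn _ : 0 < K)%N hC; clearbody K; clear; nia.
  move=> S hS Srq; set q := p.+2 in hS Srq *.
  have q1 : 1 <= q%:R :> R by rewrite ler1n.
  have qd1 : 1 <= q%:R `^ d by have := ler_powR q1 (ltW d0); rewrite powRr0.
  have qd0 : 0 <= q%:R `^ d by exact: powR_ge0.
  pose l := Num.truncn (q%:R `^ d).
  have l0 : (0 < l)%N by rewrite truncn_gt0.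
  have lq : (l ^ (4 * n ^ 2) <= q)%N.
    rewrite -(ler_nat R) natrX.
    have -> : q%:R = (q%:R `^ d) ^+ (4 * n ^ 2).
      by rewrite -powR_mulrn // -powRrM mulVf ?powRr1 // pnatr_eq0.
    by apply: lerXn2r; rewrite ?nnegrE //; have /andP[] := truncn_itv qd0.
  have hl : ((10 * n * l) ^ (2 * n ^ 2) < q)%N.
    (* After squaring, one factor [q] absorbs [(10 * n) ^ (4 * n ^ 2)] and the other absorbs
       [l ^ (4 * n ^ 2)]; this dictates the choice of [d]. *)
    rewrite -(@ltn_exp2r _ _ 2) // -expnM.
    have -> : (2 * n ^ 2 * 2 = 4 * n ^ 2)%N by rewrite mulnAC.
    rewrite [X in (X < _)%N]expnMn [X in (_ < X)%N]expnS expn1.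
    apply: leq_ltn_trans (leq_mul (leqnn _) lq) _.
    by rewrite ltn_pmul2r.
  have hap : kap * q%:R ^+ 2 <= (ap3count S)%:R.
    apply: hkap podd _; apply: le_trans hS; rewrite ler_wpM2r //.
    exact: level_anti.
  have [b b0 hb] := near_invariant podd (ltn0Sn _) (ltn0Sn _) l0 kap_gt0 nkap hap hl hmin mtop hS Srq.
  exists b; split.
    by rewrite ltn_ord andbT lt0n; apply: contraNneq b0 => b0; apply/eqP/val_inj.
  by move=> j; rewrite -truncn_ge_nat // => /hb.
have [q0 [_ [_ rho1_lt _]]] := hm 0%N.
exists (level R K m), d; split => //; first exact: level_gt0.
  by rewrite invf_lt1 ?ltr0n // ltr1n; lia.
move=> N; have [q [Nq [q_prime _ hS]]] := hm N; exists q; do 2?split => //.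
move=> S S_dense Srq; have [b [b_bound hb]] := hS S S_dense Srq.
exists b; split => // j /hb; apply: le_trans; rewrite ler_wpM2l // lerD2l lerN2.
(* The logarithm is nonzero as the level is below [rho0 < 1]. Since it is at most
   [top / K = 10 * C * K], the loss [64 / K] is within [c / |ln rho1|]. *)
have ln_gt0 : 0 < `|ln (level R K m)|.
  by rewrite normr_gt0 lt_eqF // ln_lt0 // level_gt0 //= (lt_trans rho1_lt).
rewrite ler_pdivlMr // -!mulrA ler_wpM2l // ler_pdivrMl ?ltr0n //.
apply: le_trans (ln_level R _ m) _ => //.
rewrite ler_pdivrMr ?ltr0n // -!natrM ler_nat; apply: leq_trans mtop _.
by rewrite -!mulnA.
Qed.
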